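(* Let $m,k\ge1$, $f\in\mathbb{Q}^m\setminus\mathbb{Z}^m$, $r^1,\dots,r^k\in\mathbb{Q}^m\setminus\{0\}$, assume $X=\{(x,s)\in\mathbb{Z}^m\times\mathbb{R}^k_+ : x=f+\sum_j r^js_j\}\neq\emptyset$, and let $P=\{(x,s)\in\mathbb{R}^m\times\mathbb{R}^k_+ : x=f+\sum_j r^js_j\}$. Let $L$ be a rational lattice-free polytope in $\mathbb{R}^m$ containing $f$ in its interior and having rays going into its corners. If the $L$-cut $\sum_{j}\psi(r^j)s_j\ge1$ has finite split rank with respect to $P$, then every face of $L_I$ that is not contained in a facet of $L$ is 2-partitionable.
   Context: Lattice-free: no integer point in the interior. $\psi(r)=\inf\{t>0: r/t\in L-f\}$ (gauge of $L-f$). The boundary point of $r^j$ is the intersection of $\{f+\lambda r^j:\lambda\ge0\}$ with the boundary of $L$; $L$ has rays going into its corners if every vertex of $L$ is the boundary point of some $r^j$. $L_I$ is the convex hull of the integer points of $L$. A split is $(\pi,\pi_0)$ with $\pi\in\mathbb{Z}^m,\pi_0\in\mathbb{Z}$ acting on $x$, with boundary hyperplanes $\{\pi x=\pi_0\}$, $\{\pi x=\pi_0+1\}$. For a polyhedron $Q$, $Q(\pi,\pi_0)=\mathrm{conv}((Q\cap\{\pi x\le\pi_0\})\cup(Q\cap\{\pi x\ge\pi_0+1\}))$; split closure = intersection of all $Q(\pi,\pi_0)$; rank-$t$ split closure defined iteratively (rank 0 is $Q$). Split rank of a valid inequality with respect to $Q$: least $t$ with the inequality valid for the rank-$t$ split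 closure of $Q$, or $+\infty$. A set of points is 2-partitionable if it has at most one element or it can be partitioned into two nonempty sets lying respectively on the two boundary hyperplanes of some split; a polytope is 2-partitionable if its set of integer points is. *)

(* Defs.v *)
From HB Require Import structures.
From mathcomp Require Import all_boot all_order all_algebra.
From mathcomp Require Import boolp classical_sets reals.
Set Implicit Arguments. Unset Strict Implicit. Unset Printing Implicit Defensive.
Import Order.TTheory GRing.Theory Num.Theory.
Local Open Scope ring_scope.
Local Open Scope classical_set_scope.

Section Defs.
Variable R : realType.

Definition conv (V : lmodType R) (A : set V) : set V :=
  [set x | exists n (w : 'I_n -> R) (p : 'I_n -> V),
     (forall i, 0 <= w i) /\ \sum_(i < n) w i = 1 /\
     (forall i, A (p i)) /\ x = \sum_(i < n) w i *: p i].

Definition is_integral_vec n (x : 'rV[R]_n) : Prop := forall i, x 0 i \is a Num.int.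
Definition is_rational_vec n (x : 'rV[R]_n) : Prop := forall i, exists q : rat, x 0 i = ratr q.

Definition dotv n (a x : 'rV[R]_n) : R := \sum_(i < n) a 0 i * x 0 i.

Definition zdot n (pi : 'I_n -> int) (x : 'rV[R]_n) : R := \sum_(i < n) (pi i)%:~R * x 0 i.

Definition interior_pts n (L : set 'rV[R]_n) : set 'rV[R]_n :=
  [set x | exists2 e : R, 0 < e & forall y : 'rV[R]_n,
     (forall i, `|y 0 i - x 0 i| < e) -> L y].

Definition lattice_free n (L : set 'rV[R]_n) : Prop :=
  forall x, is_integral_vec x -> ~ interior_pts L x.

Definition rational_polytope n (L : set 'rV[R]_n) : Prop :=
  exists N (v : 'I_N -> 'rV[R]_n), (forall i, is_rational_vec (v i)) /\ L = conv (range v).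

(* gauge of L - f *)
Definition psi n (L : set 'rV[R]_n) (f r : 'rV[R]_n) : R :=
  inf [set t : R | 0 < t /\ L (f + t^-1 *: r)].

Definition vertex n (L : set 'rV[R]_n) (v : 'rV[R]_n) : Prop :=
  L v /\ forall x y t, L x -> L y -> 0 < t < 1 -> v = (1 - t) *: x + t *: y -> x = y.

Definition boundary_point_of n (L : set 'rV[R]_n) (f r p : 'rV[R]_n) : Prop :=
  (exists2 lam : R, 0 <= lam & p = f + lam *: r) /\ L p /\ ~ interior_pts L p.

Definition rays_into_corners n k (L : set 'rV[R]_n) (f : 'rV[R]_n) (r : 'I_k -> 'rV[R]_n) : Prop :=
  forall v, vertex L v -> exists j, boundary_point_of L f (r j) v.

Definition integer_hull n (L : set 'rV[R]_n) : set 'rV[R]_n :=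
  conv [set x | L x /\ is_integral_vec x].

Definition face n (S F : set 'rV[R]_n) : Prop :=
  exists (a : 'rV[R]_n) (b : R), (forall x, S x -> dotv a x <= b) /\
    F = [set x | S x /\ dotv a x = b].

Definition aff_indep n d (p : 'I_d -> 'rV[R]_n) : bool :=
  row_free (row_mx (const_mx 1 : 'M[R]_(d, 1)) (\matrix_(i < d, j < n) p i 0 j)).

Definition aff_dim n (F : set 'rV[R]_n) (d : nat) : Prop :=
  (exists p : 'I_d.+1 -> 'rV[R]_n, (forall i, F (p i)) /\ aff_indep p) /\
  (forall p : 'I_d.+2 -> 'rV[R]_n, (forall i, F (p i)) -> ~~ aff_indep p).

Definition facet n (L G : set 'rV[R]_n) : Prop := face L G /\ aff_dim G n.-1.

Definition two_partitionable_set n (S : set 'rV[R]_n) : Prop :=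
  (forall x y, S x -> S y -> x = y) \/
  exists (pi : 'I_n -> int) (pi0 : int) (S1 S2 : set 'rV[R]_n),
    S1 !=set0 /\ S2 !=set0 /\ S1 `&` S2 = set0 /\ S = S1 `|` S2 /\
    (forall x, S1 x -> zdot pi x = pi0%:~R) /\
    (forall x, S2 x -> zdot pi x = (pi0 + 1)%:~R).

Definition two_partitionable n (F : set 'rV[R]_n) : Prop :=
  two_partitionable_set [set x | F x /\ is_integral_vec x].

Definition split_set m k (Q : set ('rV[R]_m * 'rV[R]_k)) (pi : 'I_m -> int) (pi0 : int)
  : set ('rV[R]_m * 'rV[R]_k) :=
  conv ([set p | Q p /\ zdot pi p.1 <= pi0%:~R] `|`
        [set p | Q p /\ (pi0 + 1)%:~R <= zdot pi p.1]).

Definition split_closure m k (Q : set ('rV[R]_m * 'rV[R]_k)) : set ('rV[R]_m * 'rV[R]_k) :=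
  [set p | forall pi pi0, split_set Q pi pi0 p].

Definition rank_split_closure m k (t : nat) (Q : set ('rV[R]_m * 'rV[R]_k)) :=
  iter t (@split_closure m k) Q.

Definition Pset m k (f : 'rV[R]_m) (r : 'I_k -> 'rV[R]_m) : set ('rV[R]_m * 'rV[R]_k) :=
  [set p : 'rV[R]_m * 'rV[R]_k | (forall j, 0 <= p.2 0 j) /\ p.1 = f + \sum_(j < k) p.2 0 j *: r j].

Definition Lcut_finite_split_rank m k (L : set 'rV[R]_m) (f : 'rV[R]_m)
  (r : 'I_k -> 'rV[R]_m) (Q : set ('rV[R]_m * 'rV[R]_k)) : Prop :=
  exists t : nat, forall p, rank_split_closure t Q p ->
    1 <= \sum_(j < k) psi L f (r j) * p.2 0 j.

End Defs.

(* Main.v *)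
Require Import Defs.
From HB Require Import structures.
From mathcomp Require Import all_boot all_order all_algebra.
From mathcomp Require Import boolp classical_sets reals.
From mathcomp Require Import ring lra zify.
Import Order.TTheory GRing.Theory Num.Theory.
Local Open Scope ring_scope.
Local Open Scope classical_set_scope.
Set Implicit Arguments.
Unset Strict Implicit.

(* Suppose the integer points y_1, ..., y_n of F are not 2-partitionable. Since F lies in
   no facet of L, their barycentre xbar is interior to L. As the rays go into the corners,
   each y_i lifts to (y_i, s_i) in P with L-cut value at most 1, while xbar lifts to P with
   value strictly less than 1. The barycentre of the lifted y_i, moved slightly towards
   that lift of xbar, survives every split closure, with a smaller but positive
   displacement at each rank, so no rank-t closure satisfies the L-cut.

   That a boundary point of L lies on a facet is obtained from Farkas' lemma: a
   supporting functional is pushed to a vertex of the polar of L - f, where the tight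
   generators of L have full rank. *)

(** * Convex hulls and convex combinations *)

Section Convexity.
Context {R : realType} {V : lmodType R}.
Implicit Types (S A : set V) (x y : V).

Definition convex_set S :=
  forall x y (t : R), 0 <= t <= 1 -> S x -> S y -> S ((1 - t) *: x + t *: y).

Lemma conv_convex A : convex_set (conv A).
Proof.
move=> x y t t01 [n1 [w1 [p1 [w1p [w11 [Ap1 ->]]]]]].
move=> [n2 [w2 [p2 [w2p [w21 [Ap2 ->]]]]]].
exists (n1 + n2)%N.
exists (fun i => match split i with inl j => (1 - t) * w1 j | inr j => t * w2 j end).
exists (fun i => match split i with inl j => p1 j | inr j => p2 j end).
have sl (j : 'I_n1) : split (lshift n2 j) = inl j by exact: (unsplitK (inl j)).
have sr (j : 'I_n2) : split (rshift n1 j) = inr j by exact: (unsplitK (inr j)).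
split; first by move=> i; case: (split i) => j; apply: mulr_ge0 => //; lra.
split.
  rewrite big_split_ord /=.
  under eq_bigr do rewrite sl.
  under [X in _ + X]eq_bigr do rewrite sr.
  by rewrite -!mulr_sumr w11 w21; ring.
split; first by move=> i; case: (split i).
rewrite big_split_ord /=.
under [in RHS]eq_bigr do rewrite sl -scalerA.
under [X in _ = _ + X]eq_bigr do rewrite sr -scalerA.
by rewrite -!scaler_sumr.
Qed.

Lemma convex_comb S (I : finType) (w : I -> R) (p : I -> V) : convex_set S ->
  (forall i, 0 <= w i) -> \sum_i w i = 1 -> (forall i, 0 < w i -> S (p i)) ->
  S (\sum_i w i *: p i).
Proof.
move=> cS w0 w1 Sp.
(* Each partial sum is its total weight times some [z], which is in [S] once that weight is
   positive; a total weight of zero then needs no division. *)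
suff H (s : seq I) : exists2 z, (0 < \sum_(i <- s) w i -> S z) &
    \sum_(i <- s) w i *: p i = (\sum_(i <- s) w i) *: z.
  have [z Sz ->] := H (index_enum I).
  by rewrite w1 scale1r; apply: Sz; rewrite w1.
elim: s => [|a s [z Sz IH]].
  by exists 0; rewrite !big_nil ?ltxx ?scaler0.
rewrite !big_cons IH.
have Ws0 : 0 <= \sum_(j <- s) w j by apply: sumr_ge0.
have [wa0|wa0] := eqVneq (w a) 0.
  by exists z; rewrite wa0 !(add0r, scale0r).
have wap : 0 < w a by rewrite lt_def wa0 w0.
have [Wsz|Wsn] := eqVneq (\sum_(j <- s) w j) 0.
  by exists (p a); rewrite Wsz ?scale0r ?addr0 // => _; apply: Sp.
have Wsp : 0 < \sum_(j <- s) w j by rewrite lt_def Wsn.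
set W := \sum_(j <- s) w j in Ws0 Wsn Wsp Sz *.
exists ((1 - W / (w a + W)) *: p a + (W / (w a + W)) *: z).
  move=> _; apply: cS; [|exact: Sp|exact: Sz].
  by rewrite divr_ge0 ?ler_pdivrMr ?mul1r ?lerDr //= ?addr_ge0 ?addr_gt0.
have nz : w a + W != 0 by rewrite gt_eqF // addr_gt0.
rewrite scalerDr !scalerA; congr (_ *: _ + _ *: _); field => //.
Qed.

Lemma conv_min A S : convex_set S -> A `<=` S -> conv A `<=` S.
Proof.
move=> cS AS x [n [w [p [w0 [w1 [Ap ->]]]]]].
by apply: convex_comb => // i _; apply: AS.
Qed.

Lemma sub_conv A : A `<=` conv A.
Proof.
move=> x Ax; exists 1%N, (fun=> 1), (fun=> x).
by rewrite !big_ord1 scale1r; do !split.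
Qed.

Lemma convex_avg S n (p : 'I_n.+1 -> V) : convex_set S -> (forall i, S (p i)) ->
  S (n.+1%:R^-1 *: \sum_i p i).
Proof.
move=> cS Sp; rewrite scaler_sumr; apply: convex_comb => //.
  by move=> i; rewrite invr_ge0 ler0n.
by rewrite sumr_const card_ord -(mulr_natr _^-1) mulVf ?pnatr_eq0.
Qed.

(** [conv] allows any number of points, with repetitions; this normal form has one weight per index,
    vanishing off [D]. Such combinations form a convex set containing the generators. *)
Lemma conv_imageP (I : finType) (D : set I) (v : I -> V) x :
  conv (v @` D) x -> exists w : I -> R, [/\ forall i, 0 <= w i, \sum_i w i = 1,
    forall i, ~ D i -> w i = 0 & x = \sum_i w i *: v i].
Proof.
move: x; apply: conv_min.
  move=> x y t t01 [a [a0 a1 aD ->]] [b [b0 b1 bD ->]].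
  exists (fun i => (1 - t) * a i + t * b i); split.
  - by move=> i; apply: addr_ge0; apply: mulr_ge0; rewrite ?a0 ?b0 //; lra.
  - by rewrite big_split /= -!mulr_sumr a1 b1 !mulr1 subrK.
  - by move=> i Di; rewrite aD // bD // !mulr0 addr0.
  - rewrite !scaler_sumr -big_split /=; apply: eq_bigr => i _.
    by rewrite [RHS]scalerDl !scalerA.
move=> _ [i Di <-]; exists (fun j => (j == i)%:R); split.
- by move=> j; rewrite ler0n.
- by rewrite (bigD1 i) //= eqxx big1 ?addr0 // => j /negbTE->.
- by move=> j Dj; case: eqP => // ji; case: Dj; rewrite ji.
- by rewrite (bigD1 i) //= eqxx scale1r big1 ?addr0 // => j /negbTE->; rewrite scale0r.
Qed.

Lemma comb_unit_weight (I : finType) (w : I -> R) (v : I -> V) i :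
  (forall j, 0 <= w j) -> \sum_j w j = 1 -> w i = 1 -> \sum_j w j *: v j = v i.
Proof.
move=> w0 w1 wi; rewrite (bigD1 i) //= wi scale1r.
rewrite big1 ?addr0 // => j ji.
have E : \sum_(j | j != i) w j = 0 by move: w1; rewrite (bigD1 i) //= wi; lra.
by rewrite (psumr_eq0P _ E) ?scale0r.
Qed.

End Convexity.

(** * A polytope is the hull of its vertices *)

Section Vertices.
Context {R : realType} {n : nat}.

(* A minimal generating subfamily consists of vertices. *)
Lemma polytope_sub_conv_vertex (I : finType) (v : I -> 'rV[R]_n) :
  conv (range v) `<=` conv (vertex (conv (range v))).
Proof.
set L := conv (range v).
pose gen (D : {set I}) := `[< forall j, conv (v @` [set i | i \in D]) (v j) >].
have [|D /minsetP[/asboolP genD minD]] := @ex_minset _ gen.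
  exists [set: I]%SET; apply/asboolP => j; apply: sub_conv.
  by exists j => //=; rewrite inE.
have LD : L `<=` conv (v @` [set i | i \in D]).
  by apply: conv_min; [exact: conv_convex|move=> _ [j _ <-]; exact: genD].
suff vD i : i \in D -> vertex L (v i).
  apply: subset_trans LD _; apply: conv_min; first exact: conv_convex.
  by move=> _ [i /= iD <-]; apply: sub_conv; apply: vD.
move=> iD; split; first by apply: sub_conv; exists i.
move=> x y t /LD/conv_imageP[a [a0 a1 aD ->]] /LD/conv_imageP[b [b0 b1 bD ->]].
move=> t01 E.
have le1 (w : I -> R) : (forall j, 0 <= w j) -> \sum_j w j = 1 -> w i <= 1.
  by move=> w0 <-; rewrite (bigD1 i) //= lerDl sumr_ge0.
pose c j := (1 - t) * a j + t * b j.
have c0 j : 0 <= c j by apply: addr_ge0; apply: mulr_ge0; rewrite ?a0 ?b0 //; lra.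
have c1 : \sum_j c j = 1 by rewrite big_split /= -!mulr_sumr a1 b1 !mulr1 subrK.
have Ec : v i = \sum_j c j *: v j.
  rewrite E !scaler_sumr -big_split /=; apply: eq_bigr => j _.
  by rewrite [RHS]scalerDl !scalerA.
(* If [c i = 1], then [a i = b i = 1] because both are at most 1 and [0 < t < 1], so both endpoints
   are [v i]. Otherwise the identity for [v i] is solved in terms of the other generators, against
   minimality of [D]. *)
have [ci|ci] := eqVneq (c i) 1.
  have := le1 _ a0 a1; have := le1 _ b0 b1 => bi ai.
  rewrite (@comb_unit_weight _ _ _ a v i) ?(@comb_unit_weight _ _ _ b v i) //.
    by move: ci; rewrite /c; nra.
  by move: ci; rewrite /c; nra.
have ci1 : c i < 1 by rewrite lt_neqAle ci le1.
have ciN : 1 - c i != 0 by rewrite subr_eq0 eq_sym.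
exfalso; suff /minD : gen (D :\ i).
  by move=> /(_ (subD1set _ _)) DD; move: iD; rewrite -DD setD11.
have vi : conv (v @` [set j | j \in D :\ i]) (v i).
  pose w j := if j == i then 0 else c j / (1 - c i).
  have -> : v i = \sum_j w j *: v j.
    rewrite (bigD1 i) //= /w eqxx scale0r add0r.
    under eq_bigr => j /negbTE-> do rewrite mulrC -scalerA.
    rewrite -scaler_sumr; apply: (scalerI ciN).
    rewrite scalerA mulfV // scale1r scalerBl scale1r {1}Ec.
    by rewrite (bigD1 i) //= addrAC subrr add0r.
  apply: convex_comb; first exact: conv_convex.
  - by move=> j; rewrite /w; case: ifP => // _; rewrite divr_ge0 // subr_ge0 ltW.
  - rewrite (bigD1 i) //= /w eqxx add0r.
    under eq_bigr => j /negbTE-> do rewrite mulrC.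
    rewrite -mulr_sumr; apply: (mulfI ciN); rewrite mulrA mulfV // mul1r mulr1.
    by rewrite -c1 [X in _ = X - _](bigD1 i) //= addrAC subrr add0r.
  - move=> j; rewrite /w; case: eqP => [_|/eqP ji cj]; first by rewrite ltxx.
    apply: sub_conv; exists j => //=; rewrite !inE ji /=.
    apply: contraPT cj => /negP jD.
    by rewrite /c aD // bD // !mulr0 addr0 mul0r ltxx.
apply/asboolP => j; move: (genD j); apply: conv_min; first exact: conv_convex.
move=> _ [l /= lD <-]; have [->//|li] := eqVneq l i.
by apply: sub_conv; exists l => //=; rewrite !inE li.
Qed.

End Vertices.

(** * Dot products and Farkas' lemma *)

Section Farkas.
Context {R : realType}.

Lemma dotvC n (a x : 'rV[R]_n) : dotv a x = dotv x a.
Proof. by apply: eq_bigr => i _; rewrite mulrC. Qed.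

Lemma dotvD n (a x y : 'rV[R]_n) : dotv a (x + y) = dotv a x + dotv a y.
Proof. by rewrite -big_split; apply: eq_bigr => i _; rewrite mxE mulrDr. Qed.

Lemma dotvZ n (a : 'rV[R]_n) c x : dotv a (c *: x) = c * dotv a x.
Proof. by rewrite mulr_sumr; apply: eq_bigr => i _; rewrite mxE mulrCA. Qed.

Lemma dotvB n (a x y : 'rV[R]_n) : dotv a (x - y) = dotv a x - dotv a y.
Proof. by rewrite -scaleN1r dotvD dotvZ mulN1r. Qed.

Lemma dotv0 n (a : 'rV[R]_n) : dotv a 0 = 0.
Proof. by rewrite -(scale0r 0) dotvZ mul0r. Qed.

Lemma dotv_sum n (I : finType) (a : 'rV[R]_n) (F : I -> 'rV[R]_n) :
  dotv a (\sum_i F i) = \sum_i dotv a (F i).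
Proof.
by apply: (big_morph (dotv a)) => [x y|]; rewrite ?dotvD ?dotv0.
Qed.

Lemma dotvDl n (a b x : 'rV[R]_n) : dotv (a + b) x = dotv a x + dotv b x.
Proof. by rewrite dotvC dotvD !(dotvC x). Qed.

Lemma dotvZl n c (a x : 'rV[R]_n) : dotv (c *: a) x = c * dotv a x.
Proof. by rewrite dotvC dotvZ dotvC. Qed.

Lemma dotvv_gt0 n (a : 'rV[R]_n) : a != 0 -> 0 < dotv a a.
Proof.
move=> a0; rewrite lt_def sumr_ge0 ?andbT; last by move=> i _; rewrite -expr2 sqr_ge0.
apply: contra a0 => /eqP E; apply/eqP/rowP => i; rewrite mxE.
have /(_ i isT)/eqP := psumr_eq0P (fun j _ => sqr_ge0 (a 0 j)) E.
by rewrite mulf_eq0 orbb => /eqP.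
Qed.

(** Algebraic proof, removing one functional at a time. A conic representation without [al ord0]
    extends by the coefficient 0; a solution [xh] of the smaller system either satisfies [al ord0]
    as well or serves as the direction of a projection. *)
Lemma farkas n N (al : 'I_N -> 'rV[R]_n) (g : 'rV[R]_n) :
  (exists x, (forall i, dotv (al i) x <= 0) /\ 0 < dotv g x) \/
  (exists lam : 'I_N -> R, (forall i, 0 <= lam i) /\ g = \sum_i lam i *: al i).
Proof.
elim: N al g => [|N IH] al g.
  have [->|g0] := eqVneq g 0; last by left; exists g; split; [case|exact: dotvv_gt0].
  by right; exists (fun=> 0); split => //; rewrite big_ord0.
have [[xh [xh_le xh_gt]]|[lam [lam0 ->]]] := IH (fun i => al (lift ord0 i)) g; last first.
  right; exists (fun i => if unlift ord0 i is Some j then lam j else 0); split.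
    by move=> i; case: unliftP.
  rewrite big_ord_recl unlift_none scale0r add0r.
  by apply: eq_bigr => i _; rewrite liftK.
have [a0|a0] := lerP (dotv (al ord0) xh) 0.
  left; exists xh; split=> // i.
  by case: (unliftP ord0 i) => [j ->|->]; [exact: xh_le|].
(* Project along the solution [xh] of the smaller system onto the hyperplane
   orthogonal to the remaining functional. *)
pose pr (b : 'rV[R]_n) := b - (dotv b xh / dotv (al ord0) xh) *: al ord0.
have dpr b x : dotv (pr b) x =
    dotv b (x - (dotv (al ord0) x / dotv (al ord0) xh) *: xh).
  rewrite dotvB dotvZ dotvC dotvB dotvZ !(dotvC x) mulrAC [in RHS]mulrAC.
  by rewrite [dotv b xh * _]mulrC.
have [[x [xle xgt]]|[lam [lam0 E]]] := IH (fun i => pr (al (lift ord0 i))) (pr g).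
  left; exists (x - (dotv (al ord0) x / dotv (al ord0) xh) *: xh).
  rewrite -dpr; split=> // i; rewrite -dpr.
  case: (unliftP ord0 i) => [j ->|->]; first exact: xle.
  by rewrite dpr dotvB dotvZ divfK ?subrr ?gt_eqF.
(* Undoing the projection gives this coefficient to [al ord0]. It is nonnegative because [xh] is
   positive on [g] and on [al ord0], and nonpositive on the other functionals. *)
right; pose c := dotv g xh / dotv (al ord0) xh -
  \sum_i lam i * (dotv (al (lift ord0 i)) xh / dotv (al ord0) xh).
exists (fun i => if unlift ord0 i is Some j then lam j else c); split.
  move=> i; case: unliftP => // _; rewrite /c subr_ge0.
  apply: (@le_trans _ _ 0); last by rewrite divr_ge0 // ltW.
  apply: sumr_le0 => j _; rewrite mulr_ge0_le0 //.
  by rewrite pmulr_lle0 ?invr_gt0.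
rewrite big_ord_recl unlift_none.
under eq_bigr do rewrite liftK.
have {E} : pr g = \sum_i lam i *: al (lift ord0 i) -
    (\sum_i lam i * (dotv (al (lift ord0 i)) xh / dotv (al ord0) xh)) *: al ord0.
  by rewrite E scaler_suml -sumrB; apply: eq_bigr => i _; rewrite scalerBr scalerA.
rewrite {1}/pr => /eqP; rewrite subr_eq => /eqP {1}->.
by rewrite /c scalerBl addrAC -addrA addrC.
Qed.

End Farkas.

(** * Interior points of convex sets *)

Section Interior.
Context {R : realType} {n : nat}.
Implicit Types (L : set 'rV[R]_n) (f x d : 'rV[R]_n).

Lemma interior_homothety L f x (th : R) : convex_set L -> interior_pts L f -> L x ->
  0 <= th < 1 -> interior_pts L (f + th *: (x - f)).
Proof.
move=> cL [e e0 fe] Lx /andP[th0 th1]; have u0 : 0 < 1 - th by rewrite subr_gt0.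
exists (e * (1 - th)); first exact: mulr_gt0.
(* [g] is the preimage of [y] under the contraction of ratio [1 - th] centred at [x]; it lies in the
   box around [f]. *)
move=> y ye; pose g := f + (1 - th)^-1 *: (y - (f + th *: (x - f))).
have -> : y = (1 - th) *: g + th *: x.
  rewrite /g scalerDr scalerA mulfV ?gt_eqF // scale1r.
  by apply/rowP => i; rewrite !mxE; ring.
apply: cL => //; first by rewrite th0 ltW.
apply: fe => i; rewrite !mxE [_ + _ - _]addrAC subrr add0r normrM gtr0_norm ?invr_gt0 //.
by rewrite mulrC ltr_pdivrMr //; have := ye i; rewrite !mxE.
Qed.

Lemma interior_stretch L x d : interior_pts L x -> exists2 del, 0 < del & L (x + del *: d).
Proof.
(* The summand 1 keeps [S] positive when [d = 0] and makes every coordinate of [d] strictly smaller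
   than [S]. *)
move=> [e e0 xe]; set S := 1 + \sum_i `|d 0 i|.
have S0 : 0 < S by rewrite ltr_pwDl // sumr_ge0.
exists (e / S); first exact: divr_gt0.
apply: xe => i; rewrite !mxE [_ + _ - _]addrAC subrr add0r normrM gtr0_norm ?divr_gt0 //.
rewrite mulrAC ltr_pdivrMr // ltr_pM2l // /S (bigD1 i) //=.
by rewrite addrCA ltrDl ltr_pwDl // sumr_ge0.
Qed.

End Interior.

(** * The polar of a finite point set and its vertices *)

Section Polar.
Context {R : realType} {n N : nat}.
Variable w : 'I_N -> 'rV[R]_n.

Definition in_polar (a : 'rV[R]_n) := forall i, dotv a (w i) <= 1.

(** Farkas in one more dimension, with functionals [(w j, -1)] and [(-z, 1)] and target [(0, 1)]. A
    solution [(y, c)] has [c > 0], and [y / c] is the polar point. In the dual case the weight [mu]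
    of [(-z, 1)] exceeds the sum of the others by 1, so dividing by [mu] leaves a total below 1. *)
Lemma polar_separation (z : 'rV[R]_n) :
  (exists a, in_polar a /\ 1 <= dotv a z) \/
  (exists lam : 'I_N -> R, [/\ forall i, 0 <= lam i, \sum_i lam i < 1 &
     z = \sum_i lam i *: w i]).
Proof.
have dot_row (a c : 'rV[R]_n) (b d : 'rV[R]_1) :
    dotv (row_mx a b) (row_mx c d) = dotv a c + b 0 0 * d 0 0.
  rewrite /dotv big_split_ord /= big_ord1 !row_mxEr; congr (_ + _).
  by apply: eq_bigr => i _; rewrite !row_mxEl.
pose al (i : 'I_N.+1) := if unlift ord0 i is Some j then row_mx (w j) (const_mx (-1))
  else row_mx (- z) (const_mx 1) : 'rV[R]_(n + 1).
have [[x]|[lam [lam0]]] := farkas al (row_mx 0 (const_mx 1)).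
  rewrite -(hsubmxK x) dot_row dotvC dotv0 !mxE add0r mul1r.
  set c := x 0 _; set y := lsubmx x => -[H c0]; left; exists (c^-1 *: y); split.
    move=> i; have := H (lift ord0 i).
    rewrite /al liftK dot_row !mxE -/c dotvC dotvZl => Hi.
    by rewrite mulrC ler_pdivrMr // mul1r; lra.
  have := H ord0; rewrite /al unlift_none dot_row !mxE -/c dotvC -scaleN1r dotvZ => Hi.
  by rewrite dotvZl mulrC ler_pdivlMr // mul1r; lra.
rewrite big_ord_recl /al unlift_none => E; right.
set mu := lam ord0 in E.
have Er : 1 = mu - \sum_i lam (lift ord0 i).
  have := congr1 (fun M : 'rV__ => rsubmx M 0 0) E.
  rewrite row_mxKr linearD /= linear_sum /= linearZ /= row_mxKr !mxE mulr1 summxE => ->.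
  by congr (_ + _); rewrite -sumrN; apply: eq_bigr => i _;
    rewrite liftK scale_row_mx row_mxKr !mxE mulrN1.
have El : mu *: z = \sum_i lam (lift ord0 i) *: w i.
  have := congr1 (fun M : 'rV__ => lsubmx M) E.
  rewrite row_mxKl linearD /= linear_sum /= linearZ /= row_mxKl scalerN => /esym/eqP.
  rewrite addrC subr_eq0 => /eqP <-.
  by apply: eq_bigr => i _; rewrite liftK scale_row_mx row_mxKl.
have sge0 : 0 <= \sum_i lam (lift ord0 i) by apply: sumr_ge0.
have mu0 : 0 < mu by lra.
exists (fun i => mu^-1 * lam (lift ord0 i)); split.
- by move=> i; rewrite mulr_ge0 // invr_ge0 ltW.
- by rewrite -mulr_sumr mulrC ltr_pdivrMr // mul1r; lra.
- under eq_bigr do rewrite -scalerA.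
  by rewrite -scaler_sumr -El scalerA mulVf ?gt_eqF // scale1r.
Qed.

(** Zero rows stand in for the slack constraints, so the size does not depend on [a] and the rank is
    that of the tight generators. *)
Definition tight_rows (a : 'rV[R]_n) : 'M[R]_(N, n) :=
  \matrix_i (if dotv a (w i) == 1 then w i else 0).

Lemma row_tight a i : dotv a (w i) = 1 -> row i (tight_rows a) = w i.
Proof. by move=> ai; rewrite rowK ai eqxx. Qed.

(* The simplex step: from a non-vertex of the polar, move along a direction that
   keeps the tight constraints until a new constraint becomes tight. *)
Lemma polar_push (z a : 'rV[R]_n) :
  (forall d, d != 0 -> exists i, 0 < dotv d (w i)) ->
  in_polar a -> 1 <= dotv a z -> ~~ row_full (tight_rows a) ->
  exists a', [/\ in_polar a', 1 <= dotv a' z & (\rank (tight_rows a) < \rank (tight_rows a'))%N].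
Proof.
move=> pos pa az nfull.
(* A kernel vector of the tight rows, with its sign chosen so that moving along it does not decrease
   the value at [z]. *)
have [d [d0 dz dT]] : exists d, [/\ d != 0, 0 <= dotv d z &
    forall i, dotv a (w i) = 1 -> dotv d (w i) = 0].
  have : kermx (tight_rows a)^T != 0.
    by rewrite kermx_eq0 /row_free mxrank_tr.
  move=> /rowV0Pn[d /sub_kermxP dT d0].
  have dw i : dotv a (w i) = 1 -> dotv d (w i) = 0.
    move=> ai; rewrite -(row_tight ai).
    have := congr1 (fun M : 'rV__ => M 0 i) dT; rewrite !mxE => <-.
    by apply: eq_bigr => j _; rewrite !mxE.
  have [dz|dz] := lerP 0 (dotv d z); first by exists d.
  exists (- d); rewrite oppr_eq0 -scaleN1r; split=> //; first by rewrite dotvZl; lra.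
  by move=> i /dw; rewrite dotvZl => ->; rewrite mulr0.
have [i0 di0] := pos d d0.
(* Ratio test: the least ratio is the longest step that stays in the polar, and its index [i1]
   becomes tight. *)
pose ratio i := (1 - dotv a (w i)) / dotv d (w i).
case: (@arg_minP _ _ _ i0 (fun i => 0 < dotv d (w i)) ratio di0) => i1 di1 min_i1.
set t := ratio i1 in min_i1.
have t0 : 0 <= t by rewrite divr_ge0 ?subr_ge0 ?(ltW di1).
exists (a + t *: d); split.
- move=> i; rewrite dotvDl dotvZl; have [di|di] := lerP (dotv d (w i)) 0.
    by rewrite -[leRHS]addr0 lerD // mulr_ge0_le0.
  by have := min_i1 i di; rewrite ler_pdivlMr //; lra.
- by rewrite dotvDl dotvZl -[leLHS]addr0 lerD // mulr_ge0.
apply: rank_ltmx; rewrite /ltmx; apply/andP; split.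
  apply/row_subP => i; have [ai|ai] := eqVneq (dotv a (w i)) 1; last first.
    by rewrite rowK (negbTE ai) sub0mx.
  rewrite (row_tight ai) -(@row_tight (a + t *: d) i) ?row_sub //.
  by rewrite dotvDl dotvZl ai dT // mulr0 addr0.
(* The rank grows strictly: [d] annihilates the old tight rows but is positive on [w i1]. *)
apply/negP => /(submx_trans (row_sub i1 _)).
rewrite row_tight; last by rewrite dotvDl dotvZl /t /ratio divfK ?gt_eqF // addrC subrK.
move=> /submxP[D wD]; move: di1; rewrite wD mulmx_sum_row dotv_sum big1 ?ltxx // => i _.
rewrite dotvZ rowK; case: eqP => [/dT->|_]; by rewrite ?dotv0 mulr0.
Qed.

(** The hypothesis on [d] says that the polar has no recession direction. Each push raises the rank,
    so induction on the corank ends at full rank. *)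
Lemma polar_vertex (z a : 'rV[R]_n) :
  (forall d, d != 0 -> exists i, 0 < dotv d (w i)) ->
  in_polar a -> 1 <= dotv a z ->
  exists a', [/\ in_polar a', 1 <= dotv a' z & row_full (tight_rows a')].
Proof.
move=> pos; have [k] := ubnP (n - \rank (tight_rows a)).
elim: k a => // k IH a lek pa az.
have [full|nfull] := boolP (row_full (tight_rows a)); first by exists a.
have [a' [pa' az' rk]] := polar_push pos pa az nfull.
apply: (IH a') => //; rewrite ltnS in lek; apply: leq_trans lek.
by rewrite ltn_sub2l // (leq_trans rk) // rank_leq_col.
Qed.

End Polar.

(** * Boundary points of a polytope lie on facets *)

Section Facets.
Context {R : realType} {n : nat}.

(** The matrix testing affine independence is square here, and the nonzero column [(-b, a)] is in
    its kernel. *)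
Lemma hyperplane_not_aff_indep (a : 'rV[R]_n.+1) b (p : 'I_n.+2 -> 'rV[R]_n.+1) :
  a != 0 -> (forall i, dotv a (p i) = b) -> ~~ aff_indep p.
Proof.
move=> a0 ap; apply/negP; rewrite /aff_indep; set M := row_mx _ _ => fM.
have uM : M \in unitmx by rewrite -row_free_unit.
pose c : 'cV[R]_(1 + n.+1) := col_mx (const_mx (- b)) a^T.
have Mc : M *m c = 0.
  rewrite mul_row_col; apply/matrixP => i j; rewrite !mxE big_ord1 !mxE mul1r.
  rewrite -(ap i) addrC; apply/eqP; rewrite subr_eq0; apply/eqP.
  by apply: eq_bigr => l _; rewrite !mxE mulrC (ord1 j).
have c0 : c = 0 by rewrite -(mulKmx uM c) Mc mulmx0.
case/eqP: a0; have := congr1 dsubmx c0; rewrite col_mxKd => E.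
by rewrite -(trmxK a) E; apply/matrixP => i j; rewrite !mxE.
Qed.

Lemma boundary_point_on_facet N (v : 'I_N -> 'rV[R]_n.+1) f x (L := conv (range v)) :
  interior_pts L f -> L x -> ~ interior_pts L x ->
  exists a b, [/\ forall y, L y -> dotv a y <= b, dotv a x = b &
    facet L [set y | L y /\ dotv a y = b]].
Proof.
move=> If Lx Ix; pose w i := v i - f.
have cL : convex_set L by exact: conv_convex.
(* Otherwise [dotv d] would be maximal over [L] at [f], although [L] extends from the interior point
   [f] along [d]. *)
have pos d : d != 0 -> exists i, 0 < dotv d (w i).
  move=> d0; apply: contrapT => npos.
  have [del del0 Ld] := interior_stretch d If.
  suff : dotv d (f + del *: d) <= dotv d f.
    rewrite dotvD dotvZ gerDl => H.
    by have := mulr_gt0 del0 (dotvv_gt0 d0); lra.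
  move: Ld; apply: (@conv_min _ _ _ [set y | dotv d y <= dotv d f]).
    move=> y1 y2 t t01 /= h1 h2; rewrite dotvD !dotvZ; nra.
  move=> _ [i _ <-] /=; rewrite leNgt; apply/negP => di; apply: npos; exists i.
  by rewrite dotvB subr_gt0.
have [[a0 [pa0 a0x]]|[lam [lam0 lam1 E]]] := polar_separation w (x - f); last first.
  (* Here [x] is the image of a point [y] of [L] under a contraction towards [f] of ratio [s < 1],
     hence interior. *)
  case: Ix; have sl : 0 <= \sum_i lam i by apply: sumr_ge0.
  have [s0|s0] := eqVneq (\sum_i lam i) 0.
    suff -> : x = f by [].
    apply/eqP; rewrite -subr_eq0 E big1 // => i _.
    by rewrite (psumr_eq0P (fun j _ => lam0 j) s0) ?scale0r.
  pose s := \sum_i lam i; pose y := \sum_i (s^-1 * lam i) *: v i.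
  have -> : x = f + s *: (y - f).
    rewrite -[LHS](subrK f) addrC E; congr (_ + _).
    rewrite /y scalerBr scaler_sumr {2}/s scaler_suml -sumrB.
    by apply: eq_bigr => i _; rewrite scalerBr scalerA mulrA mulfV // mul1r.
  apply: interior_homothety => //; last by rewrite sl.
  apply: convex_comb => //.
  - by move=> i; rewrite mulr_ge0 // invr_ge0.
  - by rewrite -mulr_sumr mulVf.
  - by move=> i _; apply: sub_conv; exists i.
have [a [pa ax full]] := polar_vertex pos pa0 a0x.
have La y : L y -> dotv a y <= 1 + dotv a f.
  apply: (@conv_min _ _ _ [set y | dotv a y <= 1 + dotv a f]).
    move=> y1 y2 t t01 /= h1 h2; rewrite dotvD !dotvZ; nra.
  by move=> _ [i _ <-] /=; have := pa i; rewrite dotvB; lra.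
exists a, (1 + dotv a f); split=> //.
  by apply/eqP; rewrite eq_le La //=; move: ax; rewrite dotvB; lra.
split; first by exists a, (1 + dotv a f).
split; last first.
  move=> p Gp; apply: (@hyperplane_not_aff_indep a (1 + dotv a f)).
    by apply/eqP => az; move: ax; rewrite az dotvC dotv0; lra.
  by move=> i; case: (Gp i).
(* Full rank selects [n.+1] independent rows. None of them is a zero filler, so all the selected
   generators are tight. *)
pose sg := fullrankfun full; pose T := rowsub sg (tight_rows w a).
have uT : T \in unitmx by exact: fullrowsub_unit.
have tight i : dotv a (w (sg i)) = 1.
  apply/eqP; apply: contraT => /negbTE ni.
  have : row i T = 0 by apply/rowP => j; rewrite !mxE ni mxE.
  move=> /(congr1 (mulmx^~ (invmx T))); rewrite -row_mul mulmxV // mul0mx.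
  by move=> /rowP/(_ i)/eqP; rewrite !mxE eqxx oner_eq0.
exists (fun i => v (sg i)); split.
  move=> i; split; first by apply: sub_conv; exists (sg i).
  by have := tight i; rewrite dotvB; lra.
(* An affine relation [u] among the [v (sg i)] has coefficient sum 0, so it is also a linear
   relation among the independent vectors [v (sg i) - f]. *)
apply: inj_row_free => u; rewrite mul_mx_row => E.
have su : \sum_i u 0 i = 0.
  have := congr1 (fun M : 'rV__ => lsubmx M 0 0) E.
  rewrite row_mxKl !mxE => E1.
  by rewrite -[RHS]E1; apply: eq_bigr => i _; rewrite mxE mulr1.
have sv : \sum_i u 0 i *: v (sg i) = 0.
  have := congr1 rsubmx E; rewrite row_mxKr linear0 mulmx_sum_row => E1.
  by rewrite -[RHS]E1; apply: eq_bigr => i _; congr (_ *: _); apply/rowP => j; rewrite !mxE.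
suff uT0 : u *m T = 0 by rewrite -(mulmxK uT u) uT0 mul0mx.
rewrite mulmx_sum_row.
transitivity (\sum_i u 0 i *: v (sg i) - (\sum_i u 0 i) *: f); last first.
  by rewrite su sv scale0r subr0.
rewrite scaler_suml -sumrB; apply: eq_bigr => i _; rewrite -scalerBr; congr (_ *: _).
by apply/rowP => j; rewrite !mxE tight eqxx !mxE.
Qed.

End Facets.

(** * Finiteness of the integer points of a bounded set *)

Section IntegerPoints.
Context {R : realType} {n : nat}.

Lemma polytope_bounded N (v : 'I_N -> 'rV[R]_n) : exists B : R,
  forall x, conv (range v) x -> forall j, `|x 0 j| <= B.
Proof.
exists (\sum_i \sum_j `|v i 0 j|).
apply: (@conv_min _ _ _ [set x : 'rV[R]_n | forall j, `|x 0 j| <= _]).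
  move=> x y t t01 /= hx hy j; rewrite !mxE; have := hx j; have := hy j.
  by rewrite !ler_norml; nra.
move=> _ [i _ <-] j /=; rewrite (bigD1 i) //= (bigD1 j) //= -addrA lerDl.
by rewrite addr_ge0 ?sumr_ge0 // => l _; rewrite sumr_ge0.
Qed.

Lemma bounded_integral_finite (S : set 'rV[R]_n) (B : R) :
  (forall x, S x -> is_integral_vec x) -> (forall x, S x -> forall j, `|x 0 j| <= B) ->
  exists N (y : 'I_N -> 'rV[R]_n), S = range y.
Proof.
move=> Sint SB; pose M := Num.Def.archi_bound `|B|.
have MB : B < M%:R by apply: le_lt_trans (ler_norm B) (archi_boundP (normr_ge0 B)).
(* Integers between [-M] and [M] are coded by ordinals below [2M + 1], shifted by [M]. *)
pose dec (g : {ffun 'I_n -> 'I_(M + M).+1}) : 'rV[R]_n := \row_j ((g j)%:R - M%:R).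
pose A := [pred g | `[< S (dec g) >]].
exists #|A|, (fun i => dec (enum_val i)); apply/seteqP; split; last first.
  by move=> _ [i _ <-]; apply/asboolP; apply: (enum_valP i).
move=> x Sx.
have H j : exists l : 'I_(M + M).+1, x 0 j = l%:R - M%:R.
  have /intrP[z xz] := Sint _ Sx j; have := SB _ Sx j.
  rewrite xz ler_norml => /andP[zl zr].
  have z0 : 0 <= z + M%:Z by rewrite -(ler_int R) intrD -pmulrn; lra.
  have zM : (absz (z + M%:Z)%R < (M + M).+1)%N.
    rewrite ltnS -lez_nat gez0_abs // PoszD lerD2r -(ler_int R) -pmulrn; lra.
  exists (Ordinal zM) => /=; rewrite pmulrn gez0_abs // intrD -pmulrn; lra.
pose g := [ffun j => projT1 (cid (H j))].
have xg : x = dec g.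
  by apply/rowP => j; rewrite mxE ffunE; case: cid.
have gA : g \in A by apply/asboolP; rewrite -xg.
by exists (enum_rank_in gA g) => //; rewrite enum_rankK_in.
Qed.

End IntegerPoints.

(** * Lifting points of [L] to the polyhedron [Pset f r] *)

Section Corners.
Context {R : realType} {m k : nat}.
Variables (f : 'rV[R]_m) (r : 'I_k -> 'rV[R]_m) (L : set 'rV[R]_m).

Lemma Pset_convex : convex_set (Pset f r).
Proof.
move=> [x1 s1] [x2 s2] t t01 [/= p1 ->] [/= p2 ->]; split => /=.
- by move=> j; rewrite !mxE addr_ge0 // mulr_ge0 ?p1 ?p2 //; lra.
- transitivity (f + ((1 - t) *: \sum_j s1 0 j *: r j + t *: \sum_j s2 0 j *: r j)).
    by apply/rowP => i; rewrite !mxE; ring.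
  congr (_ + _); rewrite !scaler_sumr -big_split /=; apply: eq_bigr => j _.
  by rewrite !mxE !scalerA -scalerDl.
Qed.

Lemma psi_le (d : 'rV[R]_m) (lam : R) : 0 < lam -> L (f + lam *: d) -> psi L f d * lam <= 1.
Proof.
move=> lam0 Ld; rewrite -ler_pdivlMr // mul1r.
apply: ge_inf; last by split; rewrite ?invr_gt0 // invrK.
by exists 0 => t [/ltW].
Qed.

(** The points with such a lift form a convex set, so vertices suffice. A vertex [f + lam *: r j]
    lifts to [lam] times the [j]-th unit vector. *)
Lemma corner_multipliers x : L `<=` conv (vertex L) -> interior_pts L f ->
  rays_into_corners L f r -> L x ->
  exists s : 'rV[R]_k, Pset f r (x, s) /\ \sum_j psi L f (r j) * s 0 j <= 1.
Proof.
move=> LV If corners /LV; move: x; apply: conv_min.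
  move=> x1 x2 t t01 [s1 [P1 h1]] [s2 [P2 h2]].
  exists ((1 - t) *: s1 + t *: s2); split; first exact: Pset_convex t01 P1 P2.
  have -> : \sum_j psi L f (r j) * ((1 - t) *: s1 + t *: s2) 0 j =
      (1 - t) * \sum_j psi L f (r j) * s1 0 j + t * \sum_j psi L f (r j) * s2 0 j.
    by rewrite !mulr_sumr -big_split /=; apply: eq_bigr => j _; rewrite !mxE /=; ring.
  nra.
move=> x Vx; have [j [[lam lam0 xE] [Lx Ix]]] := corners x Vx.
(* With [lam = 0] the vertex would be [f], which is interior. *)
have lamp : 0 < lam.
  rewrite lt_def lam0 andbT; apply/eqP => lamz; apply: Ix.
  by rewrite xE lamz scale0r addr0.
exists (\row_i (if i == j then lam else 0)); split; first split => /=.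
- by move=> i; rewrite mxE; case: ifP.
- rewrite xE (bigD1 j) //= mxE eqxx big1 ?addr0 // => i /negbTE ij.
  by rewrite mxE ij scale0r.
rewrite (bigD1 j) //= mxE eqxx big1 ?addr0; last by move=> i /negbTE ij; rewrite mxE ij mulr0.
by apply: psi_le; rewrite -?xE.
Qed.

(** Lift a point of [L] slightly beyond [x] on the line from [f], then scale the multipliers back by
    [1 / (1 + del)]; the cut value shrinks by that factor. *)
Lemma corner_multipliers_interior x : L `<=` conv (vertex L) -> interior_pts L f ->
  rays_into_corners L f r -> interior_pts L x ->
  exists s : 'rV[R]_k, Pset f r (x, s) /\ \sum_j psi L f (r j) * s 0 j < 1.
Proof.
move=> LV If corners Ix.
have [del del0 Ld] := interior_stretch (x - f) Ix.
have [s [[/= s0 sE] s1]] := corner_multipliers LV If corners Ld.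
have d1 : 0 < 1 + del by lra.
exists ((1 + del)^-1 *: s); split; first split => /=.
- by move=> j; rewrite mxE mulr_ge0 // invr_ge0 ltW.
- have -> : \sum_j ((1 + del)^-1 *: s) 0 j *: r j = (1 + del)^-1 *: \sum_j s 0 j *: r j.
    by rewrite scaler_sumr; apply: eq_bigr => j _; rewrite mxE scalerA.
  have -> : \sum_j s 0 j *: r j = (1 + del) *: (x - f).
    by rewrite -[LHS](addKr f) -sE; apply/rowP => i; rewrite !mxE; ring.
  by rewrite scalerA mulVf ?gt_eqF // scale1r addrC subrK.
have -> : \sum_j psi L f (r j) * ((1 + del)^-1 *: s) 0 j =
    (1 + del)^-1 * \sum_j psi L f (r j) * s 0 j.
  by rewrite mulr_sumr; apply: eq_bigr => j _; rewrite mxE mulrCA.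
by rewrite mulrC ltr_pdivrMr // mul1r; lra.
Qed.

End Corners.

(** * Survival of a displaced barycentre under split closures *)

Section SplitStep.
Context {R : realType} {m k : nat}.

Lemma split_closure_convex (Q : set ('rV[R]_m * 'rV[R]_k)) : convex_set (split_closure Q).
Proof.
move=> x y t t01 Qx Qy pi pi0; apply: conv_convex => //; [exact: Qx|exact: Qy].
Qed.

Lemma zdotE (pi : 'I_m -> int) (x : 'rV[R]_m) : zdot pi x = dotv (\row_i (pi i)%:~R) x.
Proof. by apply: eq_bigr => i _; rewrite mxE. Qed.

Lemma zdot_integral (pi : 'I_m -> int) (x : 'rV[R]_m) : is_integral_vec x ->
  exists z : int, zdot pi x = z%:~R.
Proof.
move=> ix; apply/intrP; apply: rpred_sum => i _; apply: rpredM; first exact: intr_int.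
exact: ix.
Qed.

Lemma split_closure_integral (Q : set ('rV[R]_m * 'rV[R]_k)) p :
  Q p -> is_integral_vec p.1 -> split_closure Q p.
Proof.
move=> Qp ip pi pi0; apply: sub_conv; have [z Ez] := zdot_integral pi ip.
have [zl|zr] := lerP z pi0; [left|right]; split=> //; rewrite Ez ler_int //.
by rewrite lezD1.
Qed.

(* Integer points survive every split. If the split strictly separates the barycentre,
   some [Y i] lies beyond it by an integer unit, so the midpoint of [Y i] and the given
   point survives; rebalancing the average then costs only a factor independent of the split. *)
Lemma split_closure_step n (Y : 'I_n.+1 -> 'rV[R]_m * 'rV[R]_k)
    (D : 'rV[R]_m * 'rV[R]_k) (Q : set ('rV[R]_m * 'rV[R]_k)) (eps : R)
    (P0 := n.+1%:R^-1 *: \sum_i Y i) :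
  (forall i, is_integral_vec (Y i).1) ->
  ~ two_partitionable_set (range (fun i => (Y i).1)) -> D.1 = 0 ->
  convex_set Q -> (forall i, Q (Y i)) -> Q (P0 + eps *: D) ->
  split_closure Q (P0 + (eps / (2 * n.+1%:R + 1)) *: D).
Proof.
move=> iY n2 D0 cQ QY Qp pi pi0; set S := split_set Q pi pi0.
have cS : convex_set S by exact: conv_convex.
have SY i : S (Y i) by apply: split_closure_integral.
have N0 : 0 < n.+1%:R :> R by rewrite ltr0n.
set N : R := n.+1%:R in N0 *.
have M0 : 0 < 2 * N + 1 by lra.
have SP0 : S P0 by exact: convex_avg.
have nN : N != 0 by rewrite gt_eqF.
have nM : 2 * N + 1 != 0 by rewrite gt_eqF.
have th01 : 0 <= (2 * N + 1)^-1 <= 1 by rewrite invr_ge0 ltW //= invf_le1 //; lra.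
apply: contrapT => nS.
have n1 : ~ S (P0 + eps *: D).
  move=> Sp; apply: nS.
  have -> : P0 + (eps / (2 * N + 1)) *: D =
      (1 - (2 * N + 1)^-1) *: P0 + (2 * N + 1)^-1 *: (P0 + eps *: D).
    by rewrite scalerDr addrA -scalerDl subrK scale1r scalerA [_ * eps]mulrC.
  exact: cS.
(* If the midpoint [q] survived, replacing [Y i] by [q] in the average would give [A], which is [P0]
   shifted by [(P0 + eps *: D - Y i) / (2N)]. Mixing in [Y i] with weight [1 / (2N + 1)] cancels the
   [Y i] term and leaves the required point; this fixes the constant. *)
have nq i : ~ S ((1 - 2^-1) *: Y i + 2^-1 *: (P0 + eps *: D)).
  move=> Sq; apply: nS; set q := _ + _ in Sq.
  pose A := N^-1 *: \sum_j (if j == i then q else Y j).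
  have SA : S A by apply: convex_avg => // j; case: ifP.
  have AE : A = P0 + N^-1 *: (q - Y i).
    rewrite /A /P0 -/N -scalerDr; congr (_ *: _).
    rewrite (bigD1 i) //= eqxx [in RHS](bigD1 i) //=.
    under eq_bigr => j /negbTE-> do [].
    by rewrite [RHS]addrC addrA subrK.
  have -> : P0 + (eps / (2 * N + 1)) *: D =
      (1 - (2 * N + 1)^-1) *: A + (2 * N + 1)^-1 *: Y i.
    rewrite AE /q; move: (Y i) P0 {SP0 Qp n1 AE SA A q Sq} D {D0} => [y1 y2] [p1 p2] [d1 d2].
    by congr (_, _); apply/rowP => j; rewrite !mxE; field; rewrite nat1r -/N nM nN.
  exact: cS.
set c := zdot pi P0.1.
have zP : zdot pi (P0 + eps *: D).1 = c by rewrite /= D0 scaler0 addr0.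
have zq i : zdot pi ((1 - 2^-1) *: Y i + 2^-1 *: (P0 + eps *: D)).1 =
    (1 - 2^-1) * zdot pi (Y i).1 + 2^-1 * c.
  by rewrite /c /= D0 scaler0 addr0 !zdotE dotvD !dotvZ.
have Qq i : Q ((1 - 2^-1) *: Y i + 2^-1 *: (P0 + eps *: D)) by apply: cQ => //; lra.
have cl : pi0%:~R < c.
  by rewrite ltNge; apply/negP => h; apply: n1; apply: sub_conv; left; split=> //; rewrite zP.
have cr : c < (pi0 + 1)%:~R.
  by rewrite ltNge; apply/negP => h; apply: n1; apply: sub_conv; right; split=> //; rewrite zP.
(* Since [c] is strictly between [pi0] and [pi0 + 1], an integer value at most [pi0 - 1] or at least
   [pi0 + 2] would put the midpoint outside the open strip, contradicting [nq]. *)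
have zY i : zdot pi (Y i).1 = pi0%:~R \/ zdot pi (Y i).1 = (pi0 + 1)%:~R.
  have [z Ez] := zdot_integral pi (iY i).
  have zl : (pi0 - 1 < z)%R.
    rewrite ltNge; apply/negP => h; apply: (nq i); apply: sub_conv; left; split=> //.
    rewrite zq Ez; move: h cr; rewrite -(ler_int R) !intrD /=; lra.
  have zr : (z < pi0 + 2)%R.
    rewrite ltNge; apply/negP => h; apply: (nq i); apply: sub_conv; right; split=> //.
    rewrite zq Ez; move: h cl; rewrite -(ler_int R) !intrD /=; lra.
  rewrite Ez; have [->|zn] := eqVneq z pi0; first by left.
  have -> : z = pi0 + 1 by lia.
  by right.
have cE : c = N^-1 * \sum_i zdot pi (Y i).1.
  rewrite /c /P0 /= zdotE dotvZ -/N; congr (_ * _).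
  rewrite (big_morph fst (id1 := 0) (op1 := +%R)) // dotv_sum.
  by apply: eq_bigr => i _; rewrite zdotE.
(* Were all [Y i] on one hyperplane, so would be their average, contradicting [cl] or [cr]; hence
   both classes below are nonempty. *)
have const (z : R) : (forall i, zdot pi (Y i).1 = z) -> c = z.
  move=> H; rewrite cE (eq_bigr (fun=> z)) // sumr_const card_ord -(mulr_natl z) -/N.
  by rewrite mulrA mulVf // mul1r.
apply: n2; right; exists pi, pi0.
exists [set x | range (fun i => (Y i).1) x /\ zdot pi x = pi0%:~R].
exists [set x | range (fun i => (Y i).1) x /\ zdot pi x = (pi0 + 1)%:~R].
split.
  apply: contrapT => H; move: cr; rewrite (const (pi0 + 1)%:~R) ?ltxx // => i.
  by case: (zY i) => // E; case: H; exists (Y i).1; split=> //; exists i.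
split.
  apply: contrapT => H; move: cl; rewrite (const pi0%:~R) ?ltxx // => i.
  by case: (zY i) => // E; case: H; exists (Y i).1; split=> //; exists i.
split.
  apply/seteqP; split=> // x [[_ E1] [_ E2]].
  by move: cl cr; rewrite -E1 -E2; lra.
split; last by split=> x [].
apply/seteqP; split=> x; last by case=> -[].
move=> Rx; have [i _ xE] := Rx.
by case: (zY i) => E; [left|right]; split=> //; rewrite -xE.
Qed.

Lemma rank_split_closure_point n (Y : 'I_n.+1 -> 'rV[R]_m * 'rV[R]_k)
    (D : 'rV[R]_m * 'rV[R]_k) (Q : set ('rV[R]_m * 'rV[R]_k)) t
    (P0 := n.+1%:R^-1 *: \sum_i Y i) :
  (forall i, is_integral_vec (Y i).1) ->
  ~ two_partitionable_set (range (fun i => (Y i).1)) -> D.1 = 0 ->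
  convex_set Q -> (forall i, Q (Y i)) -> Q (P0 + D) ->
  exists2 eps : R, 0 < eps <= 1 & rank_split_closure t Q (P0 + eps *: D).
Proof.
move=> iY n2 D0 cQ QY QD.
(* The induction must also carry the convexity of the closure and the survival of every [Y i]. *)
suff [] : [/\ convex_set (rank_split_closure t Q),
    forall i, rank_split_closure t Q (Y i) &
    exists2 eps : R, 0 < eps <= 1 & rank_split_closure t Q (P0 + eps *: D)] by [].
elim: t => [|t [ct Yt [eps /andP[eps0 eps1] Et]]].
  by split=> //; exists 1; rewrite ?scale1r ?ltr01 ?lexx.
split; first exact: split_closure_convex.
  by move=> i; exact: split_closure_integral (Yt i) (iY i).
exists (eps / (2 * n.+1%:R + 1)); last exact: split_closure_step.
have N0 : 0 <= n.+1%:R :> R by rewrite ler0n.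
by rewrite divr_gt0 /= ?ler_pdivrMr ?mul1r //; lra.
Qed.

End SplitStep.

(** * Faces of the integer hull and averages on hyperplanes *)

Section BarycentreInterior.
Context {R : realType} {m : nat}.

Lemma integer_hull_sub (L : set 'rV[R]_m) : convex_set L -> integer_hull L `<=` L.
Proof. by move=> cL; apply: conv_min => // x []. Qed.

(** A point of the face is a convex combination of integer points of [L]. Their nonnegative slacks
    have weighted sum zero, so every point of positive weight lies on the face itself. *)
Lemma face_hull_sub (L F G : set 'rV[R]_m) : face (integer_hull L) F -> convex_set G ->
  (forall x, F x -> is_integral_vec x -> G x) -> F `<=` G.
Proof.
move=> [a [b [Lb ->]]] cG FG x [Hx ax]; move: (Hx) ax.
move=> [N [w [p [w0 [w1 [Lp ->]]]]]] ax; apply: convex_comb => // i wi.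
have ple j : dotv a (p j) <= b by apply: Lb; apply: sub_conv.
have E : \sum_j w j * (b - dotv a (p j)) = 0.
  under eq_bigr do rewrite mulrBr.
  rewrite sumrB -mulr_suml w1 mul1r -ax dotv_sum.
  by under [X in X - _]eq_bigr do rewrite dotvZ; rewrite subrr.
have /(_ i isT)/eqP := psumr_eq0P (fun j _ => mulr_ge0 (w0 j) (etrans (subr_ge0 _ _) (ple j))) E.
rewrite mulf_eq0 gt_eqF //= subr_eq0 => /eqP bi.
by have [Lpi ipi] := Lp i; apply: FG => //; split=> //; apply: sub_conv.
Qed.

Lemma avg_on_hyperplane (a : 'rV[R]_m) b n (y : 'I_n.+1 -> 'rV[R]_m) :
  (forall i, dotv a (y i) <= b) -> dotv a (n.+1%:R^-1 *: \sum_i y i) = b ->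
  forall i, dotv a (y i) = b.
Proof.
move=> yb; rewrite dotvZ dotv_sum => avg i.
have N0 : n.+1%:R != 0 :> R by rewrite pnatr_eq0.
have E : \sum_i (b - dotv a (y i)) = 0.
  rewrite sumrB sumr_const card_ord -(mulr_natl b) -avg mulrA mulfV // mul1r.
  by rewrite subrr.
have := psumr_eq0P (fun j _ => etrans (subr_ge0 _ _) (yb j)) E.
by move=> /(_ i isT)/eqP; rewrite subr_eq0 => /eqP.
Qed.

End BarycentreInterior.

Theorem theorem2 (R : realType) (m k : nat) (f : 'rV[R]_m) (r : 'I_k -> 'rV[R]_m)
  (L : set 'rV[R]_m) :
  (0 < m)%N -> (0 < k)%N ->
  is_rational_vec f -> ~ is_integral_vec f ->
  (forall j, is_rational_vec (r j) /\ r j != 0) ->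
  (exists (x : 'rV[R]_m) (s : 'rV[R]_k), is_integral_vec x /\
     (forall j, 0 <= s 0 j) /\ x = f + \sum_(j < k) s 0 j *: r j) ->
  rational_polytope L -> lattice_free L -> interior_pts L f ->
  rays_into_corners L f r ->
  Lcut_finite_split_rank L f r (Pset f r) ->
  forall F, face (integer_hull L) F ->
    ~ (exists G, facet L G /\ F `<=` G) ->
    two_partitionable F.
Proof.
move=> m0 _ _ _ _ _ [N [v [_ LE]]] _ If corners [t rk] F faceF nofacet.
case: m m0 => // m _ in f r L v LE If corners rk F faceF nofacet *.
have cL : convex_set L by rewrite LE; exact: conv_convex.
have LV : L `<=` conv (vertex L) by rewrite LE; exact: polytope_sub_conv_vertex.
have FL : F `<=` L.
  by have [a [b [_ ->]]] := faceF; move=> x [Hx _]; exact: (integer_hull_sub cL).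
apply: contrapT; rewrite /two_partitionable; set S := [set x | _] => n2.
have [B LB] := polytope_bounded v.
have [|x [Fx _] j|n [y Sy]] := @bounded_integral_finite _ _ S B.
- by move=> x [].
- by apply: LB; rewrite -LE; exact: FL.
case: n y Sy => [|n] y Sy.
  (* Without integer points, [F] is 2-partitionable vacuously. *)
  by apply: n2; left => x x'; rewrite Sy => -[[]].
have FY i : F (y i) /\ is_integral_vec (y i).
  by rewrite -[_ /\ _]/(S (y i)) Sy; exists i.
have Ly i : L (y i) by apply: FL; case: (FY i).
pose xbar := n.+1%:R^-1 *: \sum_i y i.
have Ix : interior_pts L xbar.
  (* A facet through [xbar] would contain every [y i], hence all of [F]. *)
  apply: contrapT => nIx.
  have Lx : L xbar by exact: convex_avg.
  have [a [b [Lab ax Gf]]] : exists a b, [/\ forall z, L z -> dotv a z <= b,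
      dotv a xbar = b & facet L [set z | L z /\ dotv a z = b]].
    by move: If Lx nIx; rewrite LE; exact: boundary_point_on_facet.
  apply: nofacet; exists [set z | L z /\ dotv a z = b]; split=> //.
  apply: (face_hull_sub faceF).
    move=> z1 z2 u u01 [L1 e1] [L2 e2]; split; first exact: cL.
    by rewrite dotvD !dotvZ e1 e2; ring.
  move=> z Fz iz; split; first exact: FL.
  have : S z by []; rewrite Sy => -[i _ <-].
  by apply: (avg_on_hyperplane _ ax) => j; apply: Lab.
have /choice[s sP] := fun i => corner_multipliers LV If corners (Ly i).
have [sbar [Psbar sbar1]] := corner_multipliers_interior LV If corners Ix.
pose Y i := (y i, s i); pose P0 := n.+1%:R^-1 *: \sum_i Y i.
pose D := (xbar, sbar) - P0.
have P01 : P0.1 = xbar.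
  by rewrite /P0 /=; congr (_ *: _); rewrite (big_morph fst (id1 := 0) (op1 := +%R)).
have P02 : P0.2 = n.+1%:R^-1 *: \sum_i s i.
  by rewrite /P0 /=; congr (_ *: _); rewrite (big_morph snd (id1 := 0) (op1 := +%R)).
have D1 : D.1 = 0 by rewrite -[D.1]/(xbar - P0.1) P01 subrr.
have [|||||eps /andP[eps0 eps1] /rk] := @rank_split_closure_point _ _ _ n Y D (Pset f r) t _ _ D1.
- by move=> i; case: (FY i).
- by rewrite -[X in two_partitionable_set X]Sy.
- exact: Pset_convex.
- by move=> i; case: (sP i).
- by rewrite -/P0 addrC subrK.
rewrite -/P0; pose c : 'rV[R]_k := \row_j psi L f (r j).
have cE (s' : 'rV[R]_k) : \sum_j psi L f (r j) * s' 0 j = dotv c s'.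
  by apply: eq_bigr => j _; rewrite mxE.
rewrite cE -[(_ + _).2]/(P0.2 + eps *: (sbar - P0.2)) dotvD dotvZ dotvB.
have cbar : dotv c sbar < 1 by rewrite -cE.
have c0 : dotv c P0.2 <= 1.
  rewrite P02; apply: (@convex_avg _ _ [set s' | dotv c s' <= 1]) => [z1 z2 u u01 /= h1 h2|i /=].
    by rewrite dotvD !dotvZ; nra.
  by rewrite -cE; case: (sP i).
(* The value at the surviving point is [(1 - eps) * dotv c P0.2 + eps * dotv c sbar], which is below
   1 since [0 < eps <= 1]. *)
nra.
Qed.
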